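(* Let $n$ and $k$ be positive integers. There exists a $k$-diagonal magic square of order $n$ if and only if either $n=k=1$, or ($3\leq k\leq n$ and ($n$ is odd or $k$ is even)).
   Context: For positive integers $k\le n$, a $k$-magic square of order $n$ is an arrangement of the numbers $0,1,\ldots,kn-1$ in an $n\times n$ array (cells may be left empty) such that each row and each column has exactly $k$ filled cells, each of the numbers $0,1,\ldots,kn-1$ occurs exactly once in the array, and the sum of the entries of any row or any column is the same. No condition is imposed on sums along diagonals. Rows and columns are indexed by $0,1,\ldots,n-1$, with indices taken modulo $n$. A (broken) diagonal is a set of cells of the form $D_d=\{(i,j): j-i\equiv d \pmod n\}$, and $k$ consecutive diagonals are $D_d,D_{d+1},\ldots,D_{d+k-1}$ for some $d$, with subscripts modulo $n$. A $k$-diagonal magic square of order $n$ is a $k$-magic square of order $n$ whose filled cells all belong to $k$ consecutive diagonals. *)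

(* Defs.v *)
From mathcomp Require Import all_boot all_algebra.

Set Implicit Arguments.
Unset Strict Implicit.
Unset Printing Implicit Defensive.

(* An n x n array of natural numbers; [None] is an empty cell. *)
Definition array (n : nat) := 'M[option nat]_n.

Definition row_sum n (A : array n) (i : 'I_n) : nat :=
  \sum_(j < n) odflt 0 (A i j).

Definition col_sum n (A : array n) (j : 'I_n) : nat :=
  \sum_(i < n) odflt 0 (A i j).

Record magic_square (k n : nat) (A : array n) : Prop := MagicSquare {
  ms_range : 0 < k <= n;
  ms_row_filled : forall i : 'I_n, #|[set j : 'I_n | A i j]| = k;
  ms_col_filled : forall j : 'I_n, #|[set i : 'I_n | A i j]| = k;
  ms_entries : forall (i j : 'I_n) (v : nat), A i j = Some v -> v < k * n;
  ms_once : forall v : nat, v < k * n ->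
    #|[set c : 'I_n * 'I_n | A c.1 c.2 == Some v]| = 1;
  ms_sums : exists s : nat,
    (forall i : 'I_n, row_sum A i = s) /\ (forall j : 'I_n, col_sum A j = s)
}.

(* The broken diagonal j - i = d (mod n); the congruence is written with [+]
   because subtraction on [nat] is truncated.  As [d] only matters modulo n,
   it may be any natural number. *)
Definition diagonal (n d : nat) : {set 'I_n * 'I_n} :=
  [set c : 'I_n * 'I_n | c.2 == c.1 + d %[mod n]].

Definition consecutive_diagonals (k n d : nat) : {set 'I_n * 'I_n} :=
  \bigcup_(t < k) diagonal n (d + t).

Definition diagonal_magic_square (k n : nat) (A : array n) : Prop :=
  magic_square k A /\
  exists d : nat, forall i j : 'I_n,
    A i j -> (i, j) \in consecutive_diagonals k n d.

(* Main.v *)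
Require Import Defs.
From mathcomp Require Import all_boot all_algebra.
From mathcomp Require Import zify.

Set Implicit Arguments.
Unset Strict Implicit.
Unset Printing Implicit Defensive.

(* Sufficiency.  The t-th diagonal is recorded as a function [b t] of the column.
   Stacking a filling with k2 diagonals, raised by k1 n, on one with k1 diagonals gives
   one with k1 + k2 diagonals, so only k = 3, 5 (n odd) and k = 4, 6 (any n) are needed.
   Necessity.  The row sums force k (k n - 1) to be even; k = 1 forces n = 1 and k = 2
   is impossible, since the sum of a line determines each entry from the others. *)

(** * Fillings of consecutive diagonals and their stacking *)

Record magic_filling (k n : nat) (b : nat -> nat -> nat) : Prop := MagicFilling {
  mf_range : forall t j, t < k -> j < n -> b t j < k * n;
  mf_inj : forall t j t' j', t < k -> j < n -> t' < k -> j' < n ->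
    b t j = b t' j' -> t = t' /\ j = j';
  mf_sums : exists s,
    (forall j, j < n -> \sum_(t < k) b t j = s) /\
    (forall i, i < n -> \sum_(t < k) b t ((i + t) %% n) = s)
}.

Lemma magic_filling_add k1 k2 n b1 b2 :
  magic_filling k1 n b1 -> magic_filling k2 n b2 ->
  magic_filling (k1 + k2) n
    (fun t j => if t < k1 then b1 t j else k1 * n + b2 (t - k1) j).
Proof.
case=> r1 i1 [s1 [c1 w1]] [r2 i2 [s2 [c2 w2]]]; split.
- move=> t j tk jn; rewrite mulnDl; case: ifP => tk1.
    by rewrite ltn_addr ?r1.
  by rewrite ltn_add2l r2 //; lia.
- move=> t j t' j' tk jn tk' jn'.
  case: ifP => tk1; case: ifP => tk1' E.
  + exact: i1.
  + by have := r1 _ _ tk1 jn; lia.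
  + by have := r1 _ _ tk1' jn'; lia.
  + have tk2 : t - k1 < k2 by lia.
    have tk2' : t' - k1 < k2 by lia.
    have E2 : b2 (t - k1) j = b2 (t' - k1) j' by lia.
    by have [e1 e2] := i2 _ _ _ _ tk2 jn tk2' jn' E2; split; lia.
- exists (s1 + (k2 * (k1 * n) + s2)); split=> [j jn | i i_n]; rewrite big_split_ord /=.
  + congr (_ + _); first by rewrite -(c1 j jn); apply: eq_bigr => t _; rewrite ltn_ord.
    rewrite -(c2 j jn) -[X in X * (_ * _)]card_ord -sum_nat_const -big_split.
    by apply: eq_bigr => t _; rewrite ltnNge leq_addr addKn.
  + congr (_ + _); first by rewrite -(w1 i i_n); apply: eq_bigr => t _; rewrite ltn_ord.
    have n0 : 0 < n by case: (n) i_n.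
    (* The second filling starts at diagonal [k1], so row [i] meets it in what is row [i + k1] of
       that filling. *)
    rewrite -(w2 ((i + k1) %% n)) ?ltn_mod //.
    rewrite -[X in X * (_ * _)]card_ord -sum_nat_const -big_split.
    by apply: eq_bigr => t _; rewrite ltnNge leq_addr addKn modnDml addnA.
Qed.

(** * Four and six diagonals, by complementary pairs *)

(* Diagonals [2 s] and [2 s + 1] carry complementary values, so that all row sums
   agree; the column sums then agree as soon as [\sum_s h s j] does not depend on [j]. *)
Definition paired_filling (r n : nat) (h : nat -> nat -> nat) (t j : nat) : nat :=
  if odd t then (r.*2 * n).-1 - h t./2 ((j + n.-1) %% n) else h t./2 j.

Lemma big_ord_double r (F : nat -> nat) :
  \sum_(t < r.*2) F t = \sum_(s < r) (F s.*2 + F s.*2.+1).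
Proof.
elim: r => [|r IH]; first by rewrite !big_ord0.
by rewrite doubleS !big_ord_recr /= IH addnA.
Qed.

Lemma modn_pred_shift n j : j < n ->
  (j + n.-1) %% n = if j == 0 then n.-1 else j.-1.
Proof.
move=> jn; case: eqP => [->|j0]; first by rewrite modn_small; lia.
have -> : j + n.-1 = j.-1 + n by lia.
by rewrite modnDr modn_small; lia.
Qed.

(** In a row, diagonal [2 s + 1] lies one column to the right of diagonal [2 s]; the shift by
    [n - 1] undoes this, so each pair adds up to [2 r n - 1]. The third hypothesis keeps the values
    of [h] apart from all complements. *)
Lemma paired_filling_magic r n h :
  (forall s j, s < r -> j < n -> h s j < r.*2 * n) ->
  (forall s j s' j', s < r -> j < n -> s' < r -> j' < n ->
     h s j = h s' j' -> s = s' /\ j = j') ->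
  (forall s j s' j', s < r -> j < n -> s' < r -> j' < n ->
     h s j + h s' j' <> (r.*2 * n).-1) ->
  (exists c, forall j, j < n -> \sum_(s < r) h s j = c) ->
  magic_filling r.*2 n (paired_filling r n h).
Proof.
move=> hr hi hc [c hs]; split.
- move=> t j tr jn; rewrite /paired_filling.
  have tr2 : t./2 < r by lia.
  have := hr _ _ tr2 jn; case: ifP; lia.
- move=> t j t' j' tr jn tr' jn'; rewrite /paired_filling.
  have tr2 : t./2 < r by lia.
  have tr2' : t'./2 < r by lia.
  have n0 : 0 < n by lia.
  have pj : (j + n.-1) %% n < n by rewrite ltn_mod.
  have pj' : (j' + n.-1) %% n < n by rewrite ltn_mod.
  case: ifP => ot; case: ifP => ot' E.
  + have [|e1 e2] := hi _ _ _ _ tr2 pj tr2' pj'.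
      by have := hr _ _ tr2 pj; have := hr _ _ tr2' pj'; lia.
    split; first by lia.
    by move: e2; rewrite !modn_pred_shift //; case: eqP; case: eqP; lia.
  + case: (hc _ _ _ _ tr2 pj tr2' jn').
    by have := hr _ _ tr2 pj; lia.
  + case: (hc _ _ _ _ tr2' pj' tr2 jn).
    by have := hr _ _ tr2' pj'; lia.
  + by have [e1 e2] := hi _ _ _ _ tr2 jn tr2' jn' E; split; lia.
- exists (r * (r.*2 * n).-1); split=> [j jn | i i_n].
  + have n0 : 0 < n by lia.
    have pj : (j + n.-1) %% n < n by rewrite ltn_mod.
    (* Adding [c] to both sides, as the sum of [h] over the previous column on the left and over
       column [j] on the right, removes the truncated subtraction. *)
    rewrite (big_ord_double r (paired_filling r n h ^~ j)); apply: (@addIn c).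
    rewrite -{1}(hs _ pj) -{1}(hs _ jn) -[X in X * _]card_ord -sum_nat_const -!big_split /=.
    apply: eq_bigr => s _; rewrite /paired_filling /= odd_double /= doubleK uphalf_double.
    by have := hr _ _ (ltn_ord s) pj; lia.
  + have n0 : 0 < n by lia.
    rewrite (big_ord_double r (fun t => paired_filling r n h t ((i + t) %% n))).
    rewrite -[X in X * _]card_ord -sum_nat_const.
    apply: eq_bigr => s _; rewrite /paired_filling /= odd_double /= doubleK uphalf_double.
    have -> : ((i + s.*2.+1) %% n + n.-1) %% n = (i + s.*2) %% n.
      rewrite modnDml; have -> : i + s.*2.+1 + n.-1 = i + s.*2 + n by lia.
      by rewrite modnDr.
    have pj : (i + s.*2) %% n < n by rewrite ltn_mod.
    by have := hr _ _ (ltn_ord s) pj; lia.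
Qed.

(** The values [j] and [2 n - 1 - j] fill the lower half of 0, ..., 4n - 1, so their complements
    fill the upper half. *)
Lemma magic_filling4 n : exists b, magic_filling 4 n b.
Proof.
exists (paired_filling 2 n (fun s j => if s is 0 then j else n.*2.-1 - j)).
apply: (@paired_filling_magic 2).
- by case=> [|[|s]] j //; lia.
- by case=> [|[|s]] j [|[|s']] j' //; lia.
- by case=> [|[|s]] j [|[|s']] j' //; lia.
- by exists n.*2.-1 => j jn; rewrite !big_ord_recr big_ord0 /=; lia.
Qed.

(* Centre the values at 0, doubling them, so that they become the odd numbers
   between - (6n - 1) and 6n - 1.  Three functions [h s] whose absolute values exhaust
   1, 3, ..., 6n - 1 and whose sum is 1 come from splitting {0, ..., 3n - 1} into
   triples (a, b, d) with d = a + b + 1 (a even) or d = a + b (a odd): the pairs (b, d)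
   are nested around two centres, so that d - b runs twice through 1, 3, 5, ... *)
Definition triple_filling (n s j : nat) : nat :=
  if odd j then
    nth 0 [:: 3 * n + j; 5 * n + uphalf n - j./2.+1; n - uphalf n - j./2.+1] s
  else
    nth 0 [:: 3 * n - j.+1; 2 * n - uphalf n + j./2; 4 * n + uphalf n + j./2] s.

Lemma magic_filling6 n : exists b, magic_filling 6 n b.
Proof.
exists (paired_filling 3 n (triple_filling n)).
apply: (@paired_filling_magic 3).
- by rewrite /triple_filling; case=> [|[|[|s]]] j //=; case: ifP; lia.
- by rewrite /triple_filling; case=> [|[|[|s]]] j [|[|[|s']]] j' //=;
    case: ifP; case: ifP; lia.
- by rewrite /triple_filling; case=> [|[|[|s]]] j [|[|[|s']]] j' //=;
    case: ifP; case: ifP; lia.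
(* A sum 1 of three doubled and centred values means a sum (3 (6n - 1) + 1) / 2 of the values
   themselves. *)
- exists (9 * n).-1 => j jn; rewrite !big_ord_recr big_ord0 /triple_filling /=.
  by case: ifP; lia.
Qed.

(** * Three and five diagonals for odd n *)

(* [j / 2] modulo [n = 2 m + 1], translated by [m]; cyclically consecutive values
   add up to [j + m] without reduction modulo [n]. *)
Definition half_mod (n j : nat) : nat := if odd j then j./2 else j./2 + n./2.

Lemma half_mod_lt n j : odd n -> j < n -> half_mod n j < n.
Proof. by rewrite /half_mod; case: ifP; lia. Qed.

Lemma half_mod_inj n j j' : odd n -> j < n -> j' < n ->
  half_mod n j = half_mod n j' -> j = j'.
Proof. by rewrite /half_mod; case: ifP; case: ifP; lia. Qed.

Lemma modn_succ n j : j < n -> j.+1 %% n = if j.+1 == n then 0 else j.+1.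
Proof.
by move=> jn; case: eqP => [->|ne]; rewrite ?modnn // modn_small //; lia.
Qed.

Lemma half_mod_succ n j : odd n -> j < n ->
  half_mod n j + half_mod n (j.+1 %% n) = j + n./2.
Proof.
move=> on jn; rewrite modn_succ // /half_mod.
by case: eqP => /=; case: (boolP (odd j)) => /=; lia.
Qed.

Lemma half_mod_succ_modn n x : odd n ->
  half_mod n (x %% n) + half_mod n (x.+1 %% n) = x %% n + n./2.
Proof.
move=> on; have n0 : 0 < n by lia.
by rewrite -(half_mod_succ on (ltn_pmod x n0)) -[in RHS](addn1 (x %% n)) modnDml addn1.
Qed.

Lemma half_mod_succ_inj n j j' : odd n -> j < n -> j' < n ->
  half_mod n (j.+1 %% n) = half_mod n (j'.+1 %% n) -> j = j'.
Proof.
move=> on jn jn'; have n0 : 0 < n by lia.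
move=> /half_mod_inj; rewrite !ltn_mod => /(_ on n0 n0).
by rewrite !modn_succ //; case: eqP; case: eqP; lia.
Qed.

(** Diagonal [t] permutes the block of [n] values starting at [t * n]. The block offsets contribute
    equally to all lines, so only the residues [p] have to be balanced. *)
Lemma magic_filling_diagonalwise k n (p : nat -> nat -> nat) s :
  (forall t j, t < k -> j < n -> p t j < n) ->
  (forall t j j', t < k -> j < n -> j' < n -> p t j = p t j' -> j = j') ->
  (forall j, j < n -> \sum_(t < k) p t j = s) ->
  (forall i, i < n -> \sum_(t < k) p t ((i + t) %% n) = s) ->
  magic_filling k n (fun t j => t * n + p t j).
Proof.
move=> pr pi pc pw; split.
- move=> t j tk jn; have := pr _ _ tk jn; nia.
- move=> t j t' j' tk jn tk' jn' E.
  have lt1 := pr _ _ tk jn; have lt2 := pr _ _ tk' jn'.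
  have ett : t = t' by nia.
  by rewrite -ett in E tk' *; split=> //; apply: (pi t) => //; lia.
- exists (\sum_(t < k) t * n + s).
  by split=> [j jn | i i_n]; rewrite big_split /= ?pc ?pw.
Qed.

(** The outer diagonals use [half_mod] at j + 1 and j in column j, and at i + 1 and i + 2 in row i.
    Either way the arguments are consecutive, and the middle diagonal compensates their sum. *)
Lemma magic_filling3 n : odd n -> exists b, magic_filling 3 n b.
Proof.
move=> on; have n0 : 0 < n by lia.
pose p t j := nth 0 [:: half_mod n (j.+1 %% n); n.-1 - j; half_mod n j] t.
exists (fun t j => t * n + p t j).
apply: (@magic_filling_diagonalwise _ _ _ (n./2 + n.-1)); rewrite /p.
- by case=> [|[|[|t]]] j // _ jn /=; rewrite ?half_mod_lt ?ltn_mod //; lia.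
- case=> [|[|[|t]]] j j' // _ jn jn' /=.
  + exact: half_mod_succ_inj.
  + lia.
  + exact: half_mod_inj.
- move=> j jn; rewrite !big_ord_recr big_ord0 /=.
  by have := half_mod_succ on jn; lia.
- move=> i i_n; rewrite !big_ord_recr big_ord0 /= addn0.
  rewrite (modn_small i_n) addn1 addn2.
  by move: (half_mod_succ_modn i.+1 on) (ltn_pmod i.+1 n0); lia.
Qed.

Lemma magic_filling5 n : odd n -> exists b, magic_filling 5 n b.
Proof.
move=> on; have n0 : 0 < n by lia.
pose p t j :=
  nth 0 [:: half_mod n (j.+1 %% n); n.-1 - j; j; n.-1 - j; half_mod n j] t.
exists (fun t j => t * n + p t j).
apply: (@magic_filling_diagonalwise _ _ _ (n./2 + n.-1 + n.-1)); rewrite /p.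
- by case=> [|[|[|[|[|t]]]]] j // _ jn /=; rewrite ?half_mod_lt ?ltn_mod //; lia.
- case=> [|[|[|[|[|t]]]]] j j' // _ jn jn' /=.
  + exact: half_mod_succ_inj.
  + lia.
  + lia.
  + exact: half_mod_inj.
- move=> j jn; rewrite !big_ord_recr big_ord0 /=.
  by have := half_mod_succ on jn; lia.
- move=> i i_n; rewrite !big_ord_recr big_ord0 /= addn0.
  rewrite (modn_small i_n) addn1 addn2 addn3 addn4.
  (* The outer arguments are now i + 1 and i + 4. The alternating sum of the relations at i + 1, i +
     2 and i + 3 telescopes to these two, and the three middle diagonals cancel its right-hand
     side. *)
  have hm := half_mod_succ_modn _ on.
  by move: (hm i.+1) (hm i.+2) (hm i.+3) (ltn_pmod i.+1 n0) (ltn_pmod i.+3 n0); lia.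
Qed.

Lemma magic_filling_exists k n : 3 <= k -> odd n \/ ~~ odd k ->
  exists b, magic_filling k n b.
Proof.
elim/ltn_ind: k => k IH k3 par.
have [k7|k7] := leqP 7 k.
  have [|||b1 m1] := IH (k - 4); [lia | lia | case: par => ?; [by left | right; lia] |].
  have [b2 m2] := magic_filling4 n.
  have -> : k = k - 4 + 4 by lia.
  exact: ex_intro (magic_filling_add m1 m2).
move: k3 k7 par; clear IH; case: k => [|[|[|[|[|[|[|k]]]]]]] // _ _ [] //.
- exact: magic_filling3.
- by move=> _; apply: magic_filling4.
- by move=> _; apply: magic_filling4.
- exact: magic_filling5.
- by move=> _; apply: magic_filling6.
- by move=> _; apply: magic_filling6.
Qed.

(** * From fillings to arrays *)

Definition diagonal_index (n i j : nat) : nat := (j + n - i) %% n.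

Lemma diagonal_indexK n (i j : 'I_n) : (i + diagonal_index n i j) %% n = j.
Proof.
rewrite modnDmr; have -> : i + (j + n - i) = j + n by have := ltn_ord i; lia.
by rewrite modnDr modn_small.
Qed.

Lemma diagonal_index_shift n (i : 'I_n) t : t < n ->
  diagonal_index n i ((i + t) %% n) = t.
Proof.
move=> tn; rewrite /diagonal_index; have i_n := ltn_ord i.
rewrite -addnBA 1?ltnW // modnDml.
have -> : i + t + (n - i) = t + n by lia.
by rewrite modnDr modn_small.
Qed.

Lemma diagonal_index_inj n (i i' j : 'I_n) :
  diagonal_index n i j = diagonal_index n i' j -> i = i'.
Proof.
move=> E; apply/val_inj/eqP; have := diagonal_indexK i j.
rewrite -[RHS](diagonal_indexK i' j) E => /eqP.
by rewrite eqn_modDr !modn_small.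
Qed.

(** The columns are reindexed by the diagonal on which they meet row [i]. With [F] constantly 1 this
    counts filled cells. *)
Lemma sum_row_diagonals n k (F : nat -> nat -> nat) (i : 'I_n) : k <= n ->
  \sum_(j < n) (if diagonal_index n i j < k then F (diagonal_index n i j) j else 0)
  = \sum_(t < k) F t ((i + t) %% n).
Proof.
move=> kn; have n0 : 0 < n by have := ltn_ord i; lia.
pose g (t : 'I_n) : 'I_n := Ordinal (ltn_pmod (i + t) n0).
have gd t : diagonal_index n i (g t) = t by rewrite diagonal_index_shift.
have g_inj : injective g by move=> t t' E; apply: val_inj; rewrite /= -(gd t) E gd.
rewrite (reindex_inj g_inj) (big_ord_widen n (fun t => F t ((i + t) %% n)) kn).
by rewrite [RHS]big_mkcond; apply: eq_bigr => t _; rewrite gd.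
Qed.

Lemma sum_col_diagonals n k (F : nat -> nat) (j : 'I_n) : k <= n ->
  \sum_(i < n) (if diagonal_index n i j < k then F (diagonal_index n i j) else 0)
  = \sum_(t < k) F t.
Proof.
move=> kn; have n0 : 0 < n by have := ltn_ord j; lia.
pose g (i : 'I_n) : 'I_n := Ordinal (ltn_pmod (j + n - i) n0).
have g_inj : injective g by move=> i i' [] /diagonal_index_inj.
rewrite (big_ord_widen n F kn) [RHS]big_mkcond [RHS](reindex_inj g_inj).
exact: eq_bigr.
Qed.

Lemma magic_filling_square k n b : 0 < k <= n -> magic_filling k n b ->
  exists A : array n, diagonal_magic_square k A.
Proof.
move=> /andP[k0 kn] [br bi [s [bc bw]]].
pose d (i j : 'I_n) := diagonal_index n i j.
pose A : array n := (\matrix_(i, j) if (d i j < k)%N then Some (b (d i j) j) else None)%R.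
have AE i j : A i j = if d i j < k then Some (b (d i j) j) else None by rewrite mxE.
have n0 : 0 < n by lia.
exists A; split; last first.
  exists 0 => i j; rewrite AE; case: ifP => // dk _.
  apply/bigcupP; exists (Ordinal dk) => //.
  by rewrite inE /= add0n diagonal_indexK modn_small.
split.
- by rewrite k0.
- move=> i; rewrite cardsE -sum1_card big_mkcond /=.
  transitivity (\sum_(t < k) 1); last by rewrite sum1_card card_ord.
  rewrite -(sum_row_diagonals (fun _ _ => 1) i kn).
  by apply: eq_bigr => j _; rewrite unfold_in /= AE -/(d i j); case: (d i j < k).
- move=> j; rewrite cardsE -sum1_card big_mkcond /=.
  transitivity (\sum_(t < k) 1); last by rewrite sum1_card card_ord.
  rewrite -(sum_col_diagonals (fun=> 1) j kn).
  by apply: eq_bigr => i _; rewrite unfold_in /= AE -/(d i j); case: (d i j < k).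
- by move=> i j v; rewrite AE; case: ifP => // dk [<-]; apply: br.
- move=> v vk.
  pose f (c : 'I_k * 'I_n) : 'I_(k * n) := Ordinal (br _ _ (ltn_ord c.1) (ltn_ord c.2)).
  have f_inj : injective f.
    move=> [t j] [t' j'] [] /bi [] // e1 e2.
    by congr (_, _); apply: val_inj.
  (* Source and target both have k n elements, so the injective [f] attains every value. *)
  have f_onto : Ordinal vk \in codom f.
    by rewrite (inj_card_onto f_inj) // card_prod !card_ord.
  have /codomP[[t j] /(congr1 val) /= ev] := f_onto.
  have dE (c : 'I_n * 'I_n) : (A c.1 c.2 == Some v) = (d c.1 c.2 == t) && (c.2 == j).
    case: c => i j' /=; rewrite AE; apply/idP/idP.
      case: ifP => // dk /eqP[]; rewrite ev => /bi[] // e1 e2.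
      by rewrite e1 eqxx; apply/eqP/val_inj.
    by case/andP=> /eqP -> /eqP ->; rewrite ltn_ord ev.
  (* Column [j] meets diagonal [t] in row j - t modulo n. *)
  have i0 : (j + (n - t)) %% n < n by rewrite ltn_mod.
  have tn : t < n by apply: leq_trans kn.
  apply/eqP/cards1P; exists (Ordinal i0, j); apply/setP=> -[i j'].
  rewrite !inE dE xpair_eqE /=; case: (j' =P j) => [->|]; rewrite ?andbF // !andbT.
  have dt : d (Ordinal i0) j = t :> nat.
    rewrite -[RHS](diagonal_index_shift (Ordinal i0) tn) /d; congr diagonal_index.
    rewrite /= modnDml; have -> : j + (n - t) + t = j + n by lia.
    by rewrite modnDr modn_small.
  apply/eqP/eqP => [dij | -> //].
  by apply: (@diagonal_index_inj _ _ _ j); rewrite -/(d i j) dij.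
- exists s; split=> [i | j].
  + rewrite -(bw i (ltn_ord i)) -(sum_row_diagonals b i kn).
    by apply: eq_bigr => j _; rewrite AE -/(d i j); case: (d i j < k).
  + rewrite -(bc j (ltn_ord j)) -(sum_col_diagonals (b ^~ j) j kn).
    by apply: eq_bigr => i _; rewrite AE -/(d i j); case: (d i j < k).
Qed.

(** * Necessary conditions *)

Lemma row_sum_single n (A : array n) (i j : 'I_n) v :
  #|[set j : 'I_n | A i j]| = 1 -> A i j = Some v -> row_sum A i = v.
Proof.
move=> /eqP/cards1P[j0 E] Aij.
have filled j' : A i j' = (j' == j0) :> bool by have := in_set1 j' j0; rewrite -E inE.
have /eqP ej : j == j0 by rewrite -filled Aij.
rewrite /row_sum (bigD1 j) //= Aij big1 ?addn0 // => j' ne.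
by have := filled j'; rewrite -ej (negbTE ne); case: (A i j').
Qed.

Lemma row_sum_pair n (A : array n) (i j j' : 'I_n) v w :
  #|[set j : 'I_n | A i j]| = 2 -> j != j' -> A i j = Some v -> A i j' = Some w ->
  row_sum A i = v + w.
Proof.
move=> c2 ne Aij Aij'.
have E : [set j; j'] = [set j : 'I_n | A i j].
  apply/eqP; rewrite eqEcard c2 cards2 ne leqnn andbT.
  by apply/subsetP=> x /set2P[] ->; rewrite inE ?Aij ?Aij'.
rewrite /row_sum (bigD1 j) //= (bigD1 j') 1?eq_sym //= Aij Aij' big1 ?addn0 //.
move=> x /andP[n1 n2].
have := in_set2 x j j'; rewrite E inE (negbTE n1) (negbTE n2).
by case: (A i x).
Qed.

Lemma magic_square_cell k n (A : array n) v : magic_square k A -> v < k * n ->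
  exists i j, A i j = Some v.
Proof.
by case=> _ _ _ _ once _ /once/eqP/cards1P[[i j] /setP/(_ (i, j))];
  rewrite !inE eqxx => /eqP ?; exists i, j.
Qed.

Lemma magic_square_cell_uniq k n (A : array n) v i j i' j' : magic_square k A ->
  A i j = Some v -> A i' j' = Some v -> (i, j) = (i', j').
Proof.
case=> _ _ _ ent once _ e e'.
have /eqP/cards1P[c /setP E] := once v (ent _ _ _ e).
have := E (i, j); have := E (i', j'); rewrite !inE e e' eqxx.
by move=> /esym/eqP -> /esym/eqP ->.
Qed.

Lemma magic_square_total k n (A : array n) s : magic_square k A ->
  (forall i, row_sum A i = s) -> 2 * (n * s) = k * n * (k * n).-1.
Proof.
case=> _ _ _ ent once _ rs.
have <- : 'C(k * n, 2) * 2 = k * n * (k * n).-1.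
  rewrite bin2 muln2 even_halfK //; case: (k * n) => //= m.
  by rewrite oddM /= andNb.
rewrite mulnC; congr (_ * _).
rewrite -[in LHS](card_ord n) -sum_nat_const -bin2_sum big_mkord.
rewrite -(eq_bigr _ (fun i _ => rs i)) pair_big /=.
(* Each entry becomes a sum of [v] times an indicator; after exchanging the sums, [ms_once] makes
   every [v] count exactly once. *)
transitivity (\sum_(c : 'I_n * 'I_n) \sum_(v < k * n) (A c.1 c.2 == Some (v : nat)) * v).
  apply: eq_bigr => -[i j] _ /=; case e: (A i j) => [v|] /=; last by rewrite big1.
  rewrite (bigD1 (Ordinal (ent _ _ _ e))) //= eqxx mul1n big1 ?addn0 // => w.
  by rewrite -val_eqE /= eq_sym => /negbTE ne; rewrite (inj_eq Some_inj) ne.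
rewrite exchange_big; apply: eq_bigr => v _.
rewrite -big_distrl /= -big_mkcond /= sum1_card.
by have := once v (ltn_ord v); rewrite cardsE => ->; rewrite mul1n.
Qed.

(** For n at least 2 both 0 and 1 occur, each alone in its row, so both would be the magic sum. *)
Lemma magic_square1 n (A : array n) : magic_square 1 A -> n = 1.
Proof.
move=> M; have [n2|] := leqP 2 n; last by have := ms_range M; lia.
have [s [rs _]] := ms_sums M.
have lt1 : 1 < 1 * n by lia.
have [i [j e0]] := magic_square_cell M (ltnW lt1).
have [i' [j' e1]] := magic_square_cell M lt1.
have := row_sum_single (ms_row_filled M i) e0.
by have := row_sum_single (ms_row_filled M i') e1; rewrite !rs => ->.
Qed.

(* The other entry in the row of 0 and the other entry in the column of 0 would
   both equal the magic sum. *)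
Lemma magic_square2 n (A : array n) : ~ magic_square 2 A.
Proof.
move=> M; have [s [rs cs]] := ms_sums M.
have lt0 : 0 < 2 * n by have := ms_range M; lia.
have [i [j e0]] := magic_square_cell M lt0.
have other (P : pred 'I_n) x : #|[set y | P y]| = 2 -> exists2 y, x != y & P y.
  move/eqP/cards2P=> [y [z [yz E]]].
  have Py : P y by have := set21 y z; rewrite -E inE.
  have Pz : P z by have := set22 y z; rewrite -E inE.
  case: (x =P y) => [-> | /eqP]; [by exists z | by exists y].
have [j' nj fj] := other _ j (ms_row_filled M i).
have [i' ni fi] := other _ i (ms_col_filled M j).
case e1: (A i j') fj => [v|] // _; case e2: (A i' j) fi => [w|] // _.
have := row_sum_pair (ms_row_filled M i) nj e0 e1; rewrite rs add0n => ev.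
(* The column of 0 is treated as a row of the transpose. *)
have := @row_sum_pair _ (trmx A) j i i' 0 w; rewrite !mxE => /(_ _ ni e0 e2).
have -> : row_sum (trmx A) j = s.
  by rewrite -(cs j); apply: eq_bigr => x _; rewrite mxE.
have -> : [set x | trmx A j x] = [set x | A x j] by apply/setP=> x; rewrite !inE mxE.
move/(_ (ms_col_filled M j)); rewrite add0n => ew.
have [ei _] := magic_square_cell_uniq M (etrans e1 (congr1 Some (esym ev)))
  (etrans e2 (congr1 Some (esym ew))).
by rewrite ei eqxx in ni.
Qed.

Theorem mainTheorem1 (n k : nat) (hn : 0 < n) (hk : 0 < k) :
  (exists A : array n, diagonal_magic_square k A) <->
  (n = 1 /\ k = 1) \/ ((3 <= k <= n) /\ (odd n \/ ~~ odd k)).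
Proof.
split=> [[A [M _]] | [[-> ->] | [/andP[k3 kn] par]]].
- have [s [rs _]] := ms_sums M.
  have tot := magic_square_total M rs.
  have kn := ms_range M.
  case: k hk M tot kn => [|[|[|k]]] // _ M tot kn.
  + by left; rewrite (magic_square1 M).
  + by case: (magic_square2 M).
  + right; split; first by lia.
    (* Cancelling [n] in the total leaves 2 s = k (k n - 1), whose right-hand side is odd when k is
       odd and n is even. *)
    have e : 2 * s = k.+3 * (k.+3 * n).-1.
      apply/eqP; rewrite -(eqn_pmul2l hn) mulnCA tot mulnAC [n * _]mulnC mulnAC.
      by apply/eqP; lia.
    have : ~~ odd (2 * s) by rewrite oddM.
    rewrite e oddM -subn1 oddB ?muln_gt0 // oddM.
    by case: (odd n) (odd k.+3) => [] []; auto.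
- apply: (@magic_filling_square 1 1 (fun _ _ => 0)) => //; split=> //.
  + by case=> [|t] [|j] [|t'] [|j'].
  + by exists 0; split=> i _; rewrite big_ord1.
- have [b m] := magic_filling_exists k3 par.
  by apply: magic_filling_square m; lia.
Qed.
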